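(* Let $a,b\in\mathbb Z\cup\{-\infty,\infty\}$ and let $f=(f_n\colon n\in\overline{a,b})$ and $g=(g_n\colon n\in\overline{a,b})$ be real sequences such that $g$ takes no zero value and has constant sign on $\overline{a,b}$, and $\Delta g$ takes no zero value and has constant sign on $\overline{a+1,b}$. Let $r:=f/g$ on $\overline{a,b}$ and $\rho:=\Delta f/\Delta g$ on $\overline{a+1,b}$. Suppose that either (i) $b=\infty$, $\lim_{n\to\infty}f_n=0$, and $\lim_{n\to\infty}g_n=0$; or (ii) $a=-\infty$, $\lim_{n\to-\infty}f_n=0$, and $\lim_{n\to-\infty}g_n=0$. Then: if $\rho$ is nondecreasing on $\overline{a+1,b}$, then $r$ is nondecreasing on $\overline{a,b}$; if $\rho$ is nonincreasing, then $r$ is nonincreasing; if $\rho$ is (strictly) increasing, then $r$ is (strictly) increasing; and if $\rho$ is (strictly) decreasing, then $r$ is (strictly) decreasing.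
   Context: For $a,b\in\mathbb Z\cup\{-\infty,\infty\}$, $\overline{a,b}:=\{n\in\mathbb Z\colon a\le n\le b\}$ (so it is empty if $a>b$, and no infinite endpoint belongs to it). By convention $\pm\infty+1:=\pm\infty$. For a sequence $f$ on $\overline{a,b}$, $\Delta f$ is the sequence on $\overline{a+1,b}$ given by $\Delta f_n:=(\Delta f)_n:=f_n-f_{n-1}$. Quotients of sequences are taken termwise: $r_n=f_n/g_n$, $\rho_n=\Delta f_n/\Delta g_n$. *)

(* Defs.v *)
From HB Require Import structures.
From mathcomp Require Import all_boot all_order all_algebra.
From mathcomp Require Import all_classical all_reals all_analysis.

Set Implicit Arguments.
Unset Strict Implicit.
Unset Printing Implicit Defensive.

Import Order.TTheory GRing.Theory Num.Theory.
Import numFieldNormedType.Exports.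

Local Open Scope classical_set_scope.
Local Open Scope ring_scope.

(** A real sequence on an interval of integers is represented by a function
    [int -> R]; its values outside the interval are irrelevant. *)

(** Only finite integers belong to [zint a b], whatever the endpoints.  Note
    that [-oo + 1%:E = -oo] and [+oo + 1%:E = +oo] in [\bar int]. *)
Definition zint (a b : \bar int) : set int :=
  [set n | (a <= n%:E)%E /\ (n%:E <= b)%E].

Definition bdiff (R : zmodType) (f : int -> R) : int -> R :=
  fun n => f n - f (n - 1).

Definition nonvanishing_on (R : nmodType) (I : set int) (f : int -> R) : Prop :=
  forall n, I n -> f n != 0.

Definition constant_sign_on (R : realDomainType) (I : set int) (f : int -> R) :
    Prop :=
  exists s : R, forall n, I n -> Num.sg (f n) = s.

(** The library's [pinfty_nbhs] and [ninfty_nbhs] require a [numFieldType]. *)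
Definition pinfty_int : set_system int :=
  [set A | exists M : int, forall n, M <= n -> A n].

Definition ninfty_int : set_system int :=
  [set A | exists M : int, forall n, n <= M -> A n].

Global Instance proper_pinfty_int : ProperFilter pinfty_int.
Proof.
apply: Build_ProperFilter_ex.
- by move=> A [M MA]; exists M; exact: MA.
- split.
  + by exists 0.
  + move=> A B [M MA] [N NB]; exists (Order.max M N) => n.
    by rewrite ge_max => /andP[Mn Nn]; split; [exact: MA|exact: NB].
  + by move=> A B AB [M MA]; exists M => n /MA /AB.
Qed.

Global Instance proper_ninfty_int : ProperFilter ninfty_int.
Proof.
apply: Build_ProperFilter_ex.
- by move=> A [M MA]; exists M; exact: MA.
- split.
  + by exists 0.
  + move=> A B [M MA] [N NB]; exists (Order.min M N) => n.
    by rewrite le_min => /andP[nM nN]; split; [exact: MA|exact: NB].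
  + by move=> A B AB [M MA]; exists M => n /MA /AB.
Qed.

Definition nondecreasing_on (R : numDomainType) (I : set int) (f : int -> R) :
    Prop :=
  forall m n, I m -> I n -> m <= n -> f m <= f n.

Definition nonincreasing_on (R : numDomainType) (I : set int) (f : int -> R) :
    Prop :=
  forall m n, I m -> I n -> m <= n -> f n <= f m.

Definition increasing_on (R : numDomainType) (I : set int) (f : int -> R) :
    Prop :=
  forall m n, I m -> I n -> m < n -> f m < f n.

Definition decreasing_on (R : numDomainType) (I : set int) (f : int -> R) :
    Prop :=
  forall m n, I m -> I n -> m < n -> f n < f m.

(* Main.v *)
Require Import Defs.
From HB Require Import structures.
From mathcomp Require Import all_boot all_order all_algebra.
From mathcomp Require Import all_classical all_reals all_analysis.
From mathcomp Require Import ring zify.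

Set Implicit Arguments.
Unset Strict Implicit.
Unset Printing Implicit Defensive.

Import Order.TTheory GRing.Theory Num.Theory.
Import numFieldNormedType.Exports.

Local Open Scope classical_set_scope.
Local Open Scope ring_scope.

(** Fix [n] and put [h k = bdiff g n * (f k - rho n * g k)].  Then
    [bdiff h k = (rho k - rho n) * (bdiff g k * bdiff g n)] has the sign of
    [rho k - rho n], so [h] is monotone between [n] and the infinite endpoint,
    where it tends to [0]; this gives the sign of [h n], and
    [r n - r (n - 1) = - h n / (g n * g (n - 1))]. *)

(** The flag [C] lets one proof serve both the weak ([C = true]) and the strict ([C = false])
    statements. *)
Definition lteif_increasing_on (R : numDomainType) (C : bool) (I : set int)
    (f : int -> R) : Prop :=
  forall m n, I m -> I n -> m < n -> f m < f n ?<= if C.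

Lemma int_le_ind (m : int) (P : int -> Prop) :
  P m -> (forall n, m <= n -> P n -> P (n + 1)) -> forall n, m <= n -> P n.
Proof.
move=> Pm Pn n mn; have -> : n = m + `|n - m|%N%:Z by lia.
elim: `|n - m|%N => [|k Pk]; first by rewrite addr0.
have -> : m + k.+1%:Z = m + k%:Z + 1 by lia.
by apply: Pn => //; lia.
Qed.

Lemma zint_between (a b : \bar int) (m n k : int) :
  zint a b m -> zint a b n -> m <= k -> k <= n -> zint a b k.
Proof.
move=> [am _] [_ nb] mk kn; split.
- by apply: le_trans am _; rewrite lee_fin.
- by apply: le_trans nb; rewrite lee_fin.
Qed.

Lemma zint_succ (a b : \bar int) (n : int) :
  zint a b (n - 1) -> zint a b n -> zint (a + 1%:E)%E b n.
Proof.
case: a => [a||] [an _] [_ nb] //; split=> //.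
by move: an; rewrite -EFinD !lee_fin; lia.
Qed.

Lemma lteif_increasing_on_step (R : numDomainType) (C : bool) (a b : \bar int)
    (f : int -> R) :
  (forall n, zint a b (n - 1) -> zint a b n -> f (n - 1) < f n ?<= if C) ->
  lteif_increasing_on C (zint a b) f.
Proof.
move=> step m n Im In mn; have {mn} : m + 1 <= n by lia.
move: n In; suff H : forall n, m + 1 <= n ->
  zint a b n -> f m < f n ?<= if C by move=> n In mn; exact: H.
apply: int_le_ind => [Im1|n mn IH In1].
  by have := step (m + 1); rewrite addrK; apply.
have In : zint a b n by apply: (zint_between Im In1); lia.
(* Transitivity combines the flags of its two inequalities by [&&], so [C] is split as [C && C]. *)
rewrite -(andbb C); apply: lteif_trans (IH In) _.
by have := step (n + 1); rewrite addrK; apply.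
Qed.

Lemma cvg0_near_ge_le0 (R : realType) (F : set_system int)
    {FF : ProperFilter F} (h : int -> R) (c : R) :
  h n @[n --> F] --> (0 : R) -> (\forall n \near F, c <= h n) -> c <= 0.
Proof.
move=> h0 ch; rewrite -(cvg_lim _ h0)//.
by apply: limr_ge => //; exact: cvgP h0.
Qed.

(** From [n] on, [h] never drops below [h n], so its limit does not either. *)
Lemma nondecreasing_cvg0_le0 (R : realType) (h : int -> R) (n : int) :
  h k @[k --> pinfty_int] --> (0 : R) ->
  (forall k, n < k -> h (k - 1) <= h k) -> h n <= 0.
Proof.
move=> h0 hle; apply: (cvg0_near_ge_le0 h0); exists n.
apply: int_le_ind => // k nk /le_trans; apply.
by have := hle (k + 1); rewrite addrK; apply; lia.
Qed.

Lemma nonincreasing_cvg0_le0 (R : realType) (h : int -> R) (n : int) :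
  h k @[k --> ninfty_int] --> (0 : R) ->
  (forall k, k <= n -> h k <= h (k - 1)) -> h n <= 0.
Proof.
move=> h0 hle; apply: (cvg0_near_ge_le0 h0); exists n => k kn.
(* The reflection [k := - j] turns the descent from [n] towards minus infinity into an upward
   induction from [- n]. *)
have : - n <= - k by lia.
rewrite -[in h k](opprK k); move: (- k).
apply: int_le_ind => [|j nj /le_trans]; first by rewrite opprK.
by rewrite opprD; apply; apply: hle; lia.
Qed.

(** As the two signs agree, the product has the sign of the square of a nonzero value. *)
Lemma constant_sign_on_mul_gt0 (R : realDomainType) (I : set int)
    (f : int -> R) (m n : int) :
  nonvanishing_on I f -> constant_sign_on I f -> I m -> I n -> 0 < f m * f n.
Proof.
move=> f0 [s fs] Im In.
by rewrite -sgr_gt0 sgrM (fs _ In) -(fs _ Im) -sgrM sgr_gt0 -expr2 exprn_even_gt0 ?f0.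
Qed.

Lemma lteif_increasing_ratio (R : realType) (C : bool) (a b : \bar int)
    (f g : int -> R)
    (g_neq0 : nonvanishing_on (zint a b) g)
    (g_sign : constant_sign_on (zint a b) g)
    (dg_neq0 : nonvanishing_on (zint (a + 1%:E)%E b) (bdiff g))
    (dg_sign : constant_sign_on (zint (a + 1%:E)%E b) (bdiff g))
    (lim0 :
      [/\ b = +oo%E, f n @[n --> pinfty_int] --> (0 : R)
        & g n @[n --> pinfty_int] --> (0 : R)] \/
      [/\ a = -oo%E, f n @[n --> ninfty_int] --> (0 : R)
        & g n @[n --> ninfty_int] --> (0 : R)]) :
  lteif_increasing_on C (zint (a + 1%:E)%E b) (fun n => bdiff f n / bdiff g n) ->
  lteif_increasing_on C (zint a b) (fun n => f n / g n).
Proof.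
set I' := zint (a + 1%:E)%E b; set rho := fun n => bdiff f n / bdiff g n.
move=> rho_incr; apply: lteif_increasing_on_step => n In1 In.
have I'n : I' n by exact: zint_succ.
pose h k := bdiff g n * (f k - rho n * g k).
have dh k : I' k -> h k - h (k - 1) = (rho k - rho n) * (bdiff g k * bdiff g n).
  move=> I'k; have := dg_neq0 k I'k; rewrite /h /rho.
  have := dg_neq0 n I'n; rewrite /bdiff => ? ?; field.
  by apply/andP.
have gg k : I' k -> 0 < bdiff g k * bdiff g n.
  by move=> I'k; exact: (constant_sign_on_mul_gt0 dg_neq0 dg_sign).
(* The filter is kept arbitrary so that the same limit serves at either infinite end; [n] is fixed,
   hence [bdiff g n] and [rho n] are constants here. *)
have h_cvg (F : set_system int) (FF : ProperFilter F) :
    f k @[k --> F] --> (0 : R) -> g k @[k --> F] --> (0 : R) ->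
    h k @[k --> F] --> (0 : R).
  move=> f0 g0; rewrite -[X in _ --> X](mulr0 (bdiff g n)).
  apply: cvgM; first exact: cvg_cst.
  rewrite -[X in _ --> X](subr0 0) -[X in _ --> _ - X](mulr0 (rho n)).
  by apply: cvgB => //; apply: cvgM => //; exact: cvg_cst.
have h_incr k : I' k -> n < k -> h (k - 1) < h k ?<= if C.
  move=> I'k nk; rewrite -subr_lteif0r dh// -(mul0r (bdiff g k * bdiff g n)).
  by rewrite lteif_pM2r ?gg// subr_lteif0r; exact: rho_incr.
have h_decr k : I' k -> k < n -> h k < h (k - 1) ?<= if C.
  move=> I'k kn; rewrite -subr_lteifr0 dh// -(mul0r (bdiff g k * bdiff g n)).
  by rewrite lteif_pM2r ?gg// subr_lteifr0; exact: rho_incr.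
have hn : h n < 0 ?<= if C.
  case: lim0 => -[ab f0 g0].
  - have I'S k : n <= k -> I' k.
      move=> nk; case: I'n => an _; split; last by rewrite ab leey.
      by apply: le_trans an _; rewrite lee_fin.
    (* A limit preserves only weak inequalities, so any strictness comes from the single step from
       [n] to [n + 1]; after it [h (n + 1) <= 0] is enough. *)
    rewrite -(andbT C); apply: (lteif_trans (y := h (n + 1))).
      by have := h_incr (n + 1); rewrite addrK; apply; [apply: I'S|]; lia.
    apply: nondecreasing_cvg0_le0 (h_cvg _ _ f0 g0) _ => k nk.
    by apply: (@lteifW _ _ C); apply: h_incr; [apply: I'S|]; lia.
  - have I'S k : k <= n -> I' k.
      move=> nk; case: I'n => _ nb; split; first by rewrite ab leNye.
      by apply: le_trans nb; rewrite lee_fin.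
    (* [rho k < rho n] fails at [k = n], so strictness has to start at [n - 1]. *)
    have -> : h n = h (n - 1).
      by apply/eqP; rewrite -subr_eq0 dh// subrr mul0r.
    rewrite -(andbT C); apply: (lteif_trans (y := h (n - 1 - 1))).
      by apply: h_decr; [apply: I'S|]; lia.
    apply: nonincreasing_cvg0_le0 (h_cvg _ _ f0 g0) _ => k nk.
    by apply: (@lteifW _ _ C); apply: h_decr; [apply: I'S|]; lia.
(* The factor [bdiff g n] in [h] clears the denominator of [rho n], so that
   [h n = f (n - 1) * g n - f n * g (n - 1)]. *)
have r_diff : f n / g n - f (n - 1) / g (n - 1) = - h n / (g n * g (n - 1)).
  have := g_neq0 _ In; have := g_neq0 _ In1; have := dg_neq0 n I'n.
  rewrite /h /rho /bdiff => ? ? ?; field.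
  by apply/and3P.
have gg1 : 0 < g n * g (n - 1) by exact: (constant_sign_on_mul_gt0 g_neq0 g_sign).
by rewrite -subr_lteif0r r_diff lteif_pdivlMr// mul0r lteif0Nr.
Qed.

Theorem proposition1 (R : realType) (a b : \bar int) (f g : int -> R)
    (g_neq0 : nonvanishing_on (zint a b) g)
    (g_sign : constant_sign_on (zint a b) g)
    (dg_neq0 : nonvanishing_on (zint (a + 1%:E)%E b) (bdiff g))
    (dg_sign : constant_sign_on (zint (a + 1%:E)%E b) (bdiff g))
    (lim0 :
      [/\ b = +oo%E, f n @[n --> pinfty_int] --> (0 : R)
        & g n @[n --> pinfty_int] --> (0 : R)] \/
      [/\ a = -oo%E, f n @[n --> ninfty_int] --> (0 : R)
        & g n @[n --> ninfty_int] --> (0 : R)]) :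
  let r := fun n : int => f n / g n in
  let rho := fun n : int => bdiff f n / bdiff g n in
  [/\ nondecreasing_on (zint (a + 1%:E)%E b) rho ->
        nondecreasing_on (zint a b) r,
      nonincreasing_on (zint (a + 1%:E)%E b) rho ->
        nonincreasing_on (zint a b) r,
      increasing_on (zint (a + 1%:E)%E b) rho ->
        increasing_on (zint a b) r
    & decreasing_on (zint (a + 1%:E)%E b) rho ->
        decreasing_on (zint a b) r].
Proof.
move=> r rho.
have incr C := lteif_increasing_ratio (C := C) g_neq0 g_sign dg_neq0 dg_sign lim0.
(* Replacing [f] by [- f] negates both ratios and keeps the limits, which reduces the two decreasing
   claims to the increasing ones. *)
have lim0N :
    [/\ b = +oo%E, - f n @[n --> pinfty_int] --> (0 : R)
      & g n @[n --> pinfty_int] --> (0 : R)] \/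
    [/\ a = -oo%E, - f n @[n --> ninfty_int] --> (0 : R)
      & g n @[n --> ninfty_int] --> (0 : R)].
  by case: lim0 => -[ab f0 g0]; [left|right]; split=> //;
    rewrite -oppr0; exact: cvgN.
have decr C := lteif_increasing_ratio (C := C) g_neq0 g_sign dg_neq0 dg_sign lim0N.
have rhoN n : bdiff (fun n => - f n) n / bdiff g n = - rho n.
  by rewrite /rho /bdiff -opprD mulNr.
split=> rho_mono m n Im In.
(* The weak notions also compare an index with itself; that case is trivial and is split off, since
   [lteif_increasing_on] assumes [m < n]. *)
- rewrite le_eqVlt => /predU1P[->//|].
  by apply: (incr true) => // i j Ii Ij /ltW; exact: rho_mono.
- rewrite le_eqVlt => /predU1P[->//|mn].
  rewrite -lerN2 -!mulNr; apply: (decr true) Im In mn => i j Ii Ij /ltW ij.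
  by rewrite !rhoN /= lerN2 rho_mono.
- by apply: (incr false).
- move=> mn; rewrite -ltrN2 -!mulNr; apply: (decr false) Im In mn => i j Ii Ij ij.
  by rewrite !rhoN /= ltrN2 rho_mono.
Qed.
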